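(* Let $g\colon\mathbb{R}_{\ge 0}\to\mathbb{R}_{\ge 0}$ be strictly increasing, super-additive and (eventually) log-concave. Then there exists a tree $T$ of uniform growth $g$, that is, there exist a tree $T$ and constants $c_1,C_1,c_2,C_2\in\mathbb{R}_{>0}$ such that $$C_1\cdot g(c_1 r)\;\le\;|B_T(v,r)|\;\le\;C_2\cdot g(c_2 r)\qquad\text{for all } r\ge 0 \text{ and all } v\in V(T).$$
   Context: All graphs are simple and may be infinite. For a graph $G$, a vertex $v\in V(G)$ and $r\ge 0$, $B_G(v,r):=\{w\in V(G)\mid d_G(v,w)\le r\}$ is the ball of radius $r$ around $v$, where $d_G$ is the graph distance. A function $g\colon\mathbb{R}_{\ge 0}\to\mathbb{R}_{\ge 0}$ is super-additive if $g(r_1+r_2)\ge g(r_1)+g(r_2)$ for all $r_1,r_2\ge 0$. It is log-concave if $\alpha\log g(x)+\beta\log g(y)\le\log g(\alpha x+\beta y)$ for all $x,y$ and all $\alpha,\beta\in[0,1]$ with $\alpha+\beta=1$, and eventually log-concave if there is $R>0$ such that this holds for all $x,y\ge R$.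
   Formalization: The upper bound |B_T(v,r)| ≤ C_2 g(c_2 r) is proved for all r ≥ 1 rather than all r ≥ 0: super-additivity forces g(0) = 0 and g(x) → 0 as x → 0, while |B_T(v,r)| = 1 for r < 1, so it always fails near r = 0. *)

(* Defs.v *)
From HB Require Import structures.
From mathcomp Require Import all_boot all_order all_algebra finmap.
From mathcomp Require Import all_classical all_reals all_analysis.

Set Implicit Arguments.
Unset Strict Implicit.
Unset Printing Implicit Defensive.

Import Order.TTheory GRing.Theory Num.Theory.
Local Open Scope classical_set_scope.
Local Open Scope ring_scope.

(* Functions R_{>=0} -> R_{>=0} are represented by functions R -> R that are
   only constrained on the nonnegative half-line. *)
Section RealFunctions.
Variables (R : realType) (g : R -> R).

Definition nonneg_valued := forall x, 0 <= x -> 0 <= g x.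

Definition strictly_increasing := forall x y, 0 <= x -> x < y -> g x < g y.

Definition super_additive :=
  forall r1 r2, 0 <= r1 -> 0 <= r2 -> g r1 + g r2 <= g (r1 + r2).

(* The logarithm is extended-real valued, since g may vanish at 0:
   log 0 = -oo, with the library convention 0 * -oo = 0. *)
Definition log_concave_from (r0 : R) :=
  forall x y a b : R, r0 <= x -> r0 <= y ->
    0 <= a <= 1 -> 0 <= b <= 1 -> a + b = 1 ->
  (a%:E * lne (g x)%:E + b%:E * lne (g y)%:E
     <= lne (g (a * x + b * y))%:E)%E.

Definition log_concave := log_concave_from 0.

Definition eventually_log_concave := exists2 r0, 0 < r0 & log_concave_from r0.

End RealFunctions.

(* The vertex set is arbitrary: classically, every type carries a choiceType
   structure and every relation is boolean. *)
Record sgraph := SGraph {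
  vertex :> choiceType;
  adj : rel vertex;
  adj_sym : symmetric adj;
  adj_irr : irreflexive adj }.

Section Graphs.
Variable G : sgraph.

Definition walks (v w : G) : set (seq G) :=
  [set p | path (@adj G) v p /\ last v p = w].

Definition connected_graph := forall v w : G, walks v w !=set0.

(* The length condition excludes the empty sequence, and a single edge
   traversed back and forth, both of which satisfy ucycle. *)
Definition acyclic := forall c : seq G, (2 < size c)%N -> ~ ucycle (@adj G) c.

Definition is_tree :=
  [/\ [set: G] !=set0, connected_graph & acyclic].

Variable R : realType.

(* The infimum of the empty set is +oo. *)
Definition gdist (v w : G) : \bar R :=
  ereal_inf [set (size p)%:R%:E | p in walks v w].

Definition gball (v : G) (r : R) : set G := [set w | (gdist v w <= r%:E)%E].

(* The cardinality [counting] is +oo on infinite sets, so the upper bound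
   includes the finiteness of balls.  The upper bound is required for r >= 1
   only: since |B(v, r)| = 1 for 0 <= r < 1, requiring it down to r = 0 would
   force g 0 > 0, whereas every super-additive g satisfies g 0 = 0. *)
Definition uniform_growth (g : R -> R) :=
  exists c1 C1 c2 C2 : R,
    [/\ 0 < c1, 0 < C1, 0 < c2 & 0 < C2] /\
    forall (r : R) (v : G), 0 <= r ->
      ((C1 * g (c1 * r))%:E <= counting (gball v r))%E /\
      (1 <= r -> (counting (gball v r) <= (C2 * g (c2 * r))%:E)%E).

End Graphs.

(* Main.v *)
Require Import Defs.
From mathcomp Require Import all_boot all_order all_algebra.
From mathcomp Require Import all_classical all_reals all_analysis.
From mathcomp Require Import zify lra.

(* By log-concavity and super-additivity there are integers [D n >= 2] whose
   products [W n = D 0 * ... * D (n - 1)] are within a factor 2 of [g (2 ^ n)],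
   up to rescaling, and which satisfy [D (n + 1) * D n <= (D n + 1) ^ 3].

   Build blocks of size [W n] recursively: a block of level [n + 1] is a
   central block of level [n] together with [D n - 1] further copies, the root
   of each copy being joined to a vertex of the central block at the maximal
   distance [2 ^ n - 1] from the root of that block. Labelling vertices by
   their digits in the mixed radix [D], the union of all blocks is a rooted
   tree on nat in which parents are smaller than their children.

   Every vertex lies in a block of level [n], which has diameter at most [2 (2
   ^ n - 1)]: this bounds balls from below. Conversely, a walk of length less
   than [2 ^ n] cannot cross a whole block, so it stays in its initial block,
   the parent of that block, and the children of these two. The attaching
   vertices are equidistributed, so a block of level [n] has [O(D n)] children,
   and the ball has [O(W (n + 1))] vertices. *)

Set Implicit Arguments.
Unset Strict Implicit.
Unset Printing Implicit Defensive.

(** * Mixed-radix digits, parents and heights *)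

Section MixedRadix.
Variable D : nat -> nat.
Hypothesis D_gt1 : forall n, 1 < D n.

Fixpoint weight n := if n is m.+1 then weight m * D m else 1.

Definition digit n x := (x %/ weight n) %% D n.

(* The [i]-th attaching vertex of a block of level [n]: all its digits are
   nonzero, and [i] is read from the top digit down, as in a van der Corput
   sequence, so that every set of top digits is equidistributed. *)
Fixpoint spread n i :=
  if n is m.+1 then (i %% (D m).-1).+1 * weight m + spread m (i %/ (D m).-1)
  else 0.

(** The position of the lowest nonzero digit. Searching below [x] suffices for [x > 0], because
    [x < 2 ^ x <= weight x]; at 0 the value is 0. *)
Definition lowest x := find (fun n => ~~ (weight n.+1 %| x)) (iota 0 x).

(* [x] is the root of its block of level [lowest x], and the digit at that
   position is the number of this block among the copies attached to the
   central one. *)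
Definition parent x :=
  spread (lowest x) (digit (lowest x) x).-1
  + (x %/ weight (lowest x).+1) * weight (lowest x).+1.

(* The depth of [x] inside its block of level [n]. *)
Definition height n x := \sum_(j < n | digit j x != 0) 2 ^ j.

Lemma weight_gt0 n : 0 < weight n.
Proof. by elim: n => //= n IH; rewrite muln_gt0 IH (ltnW (D_gt1 n)). Qed.

Lemma D1_gt0 n : 0 < (D n).-1.
Proof. by have := D_gt1 n; case: (D n) => [|[]]. Qed.

Lemma expn2_le_weight n : 2 ^ n <= weight n.
Proof. by elim: n => // n IH; rewrite expnSr leq_mul. Qed.

Lemma dvdn_weight m n : m <= n -> weight m %| weight n.
Proof.
move=> /subnK <-; elim: (n - m) => //= k IH.
exact: dvdn_mulr.
Qed.

Lemma lowest_dvd x : weight (lowest x) %| x.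
Proof.
rewrite /lowest; case E: find => [|m]; first by rewrite dvd1n.
have hm : m < find (fun n => ~~ (weight n.+1 %| x)) (iota 0 x) by rewrite E.
have := before_find 0 hm; rewrite nth_iota; last first.
  by apply: leq_trans hm _; rewrite -[leqRHS](size_iota 0 x) find_size.
by rewrite add0n => /negbFE.
Qed.

Lemma lowest_ndvd x : 0 < x -> ~~ (weight (lowest x).+1 %| x).
Proof.
move=> x0; have hx : has (fun n => ~~ (weight n.+1 %| x)) (iota 0 x).
  apply/hasP; exists x.-1; first by rewrite mem_iota; lia.
  apply/negP => /dvdn_leq => /(_ x0); rewrite prednK // => h.
  have := leq_trans (expn2_le_weight x) h.
  by rewrite leqNgt ltn_expl.
have := nth_find 0 hx; rewrite nth_iota ?add0n //.
by move: hx; rewrite has_find size_iota.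
Qed.

Lemma ltn_lowest n x : 0 < x -> (lowest x < n) = ~~ (weight n %| x).
Proof.
move=> x0; case: (ltnP (lowest x) n) => h; symmetry.
  apply/negP => /(dvdn_trans (dvdn_weight h)) h'.
  by have := lowest_ndvd x0; rewrite h'.
apply/negbTE; rewrite negbK.
exact: dvdn_trans (dvdn_weight h) (lowest_dvd x).
Qed.

Lemma digit_ltn n x : digit n x < D n.
Proof. by rewrite ltn_mod (ltnW (D_gt1 n)). Qed.

Lemma divn_weight m n x : m <= n ->
  x %/ weight n = (x %/ weight m) %/ (weight n %/ weight m).
Proof. by move=> h; rewrite -divnMA mulnC divnK // dvdn_weight. Qed.

Lemma eq_digit m j x y : m <= j ->
  x %/ weight m = y %/ weight m -> digit j x = digit j y.
Proof. by move=> h e; rewrite /digit !(divn_weight _ h) e. Qed.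

Lemma digitDr j n y q : j < n -> digit j (y + q * weight n) = digit j y.
Proof.
move=> h; rewrite /digit.
have /dvdnP [c ->] := dvdn_weight h.
rewrite /= [weight j * _]mulnC !mulnA divnDMl ?weight_gt0 //.
by rewrite -modnDmr modnMl addn0.
Qed.

Lemma digit_dvd j n x : j < n -> weight n %| x -> digit j x = 0.
Proof.
move=> h /dvdnP [q ->]; rewrite -[_ * _]add0n digitDr // /digit div0n.
by rewrite mod0n.
Qed.

Lemma digit_lowest x : 0 < x -> 0 < digit (lowest x) x.
Proof.
move=> x0; rewrite lt0n; apply/negP => /eqP e.
have := lowest_ndvd x0; have := lowest_dvd x; move: e.
move: (lowest x) => v + /dvdnP [q xE].
rewrite xE /digit mulnK ?weight_gt0 // => /eqP h.
by rewrite /= [weight v * _]mulnC dvdn_pmul2r ?weight_gt0 // /dvdn h.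
Qed.

Lemma spread_ltn n i : spread n i < weight n.
Proof.
elim: n i => //= n IH i.
have := IH (i %/ (D n).-1); have := ltn_pmod i (D1_gt0 n); have := D_gt1 n.
set r := _ %% _; set s := spread _ _; set w := weight n => h1 h2 h3.
have : r.+2 * w <= w * D n by rewrite mulnC leq_mul2l; lia.
lia.
Qed.

Lemma digit_spread j n i : j < n -> digit j (spread n i) != 0.
Proof.
elim: n i => //= n IH i; rewrite ltnS leq_eqVlt => /orP [/eqP ->|h].
  rewrite /digit divnMDl ?weight_gt0 // divn_small ?spread_ltn // addn0.
  have := ltn_pmod i (D1_gt0 n); have := D_gt1 n => h1 h2.
  by rewrite modn_small //; lia.
by rewrite addnC digitDr // IH.
Qed.

Lemma parent_div x :
  parent x %/ weight (lowest x).+1 = x %/ weight (lowest x).+1.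
Proof.
rewrite /parent addnC divnMDl ?weight_gt0 //.
rewrite [spread _ _ %/ _]divn_small ?addn0 //.
apply: leq_trans (spread_ltn _ _) _.
by apply: dvdn_leq; rewrite ?weight_gt0 ?dvdn_weight.
Qed.

Lemma parent_divS m x : lowest x < m ->
  parent x %/ weight m = x %/ weight m.
Proof. by move=> h; rewrite !(divn_weight _ h) parent_div. Qed.

Lemma digit_parent_lt j x : j < lowest x -> digit j (parent x) != 0.
Proof. by move=> h; rewrite /parent digitDr ?digit_spread // ltnW. Qed.

Lemma digit_parent_lowest x : digit (lowest x) (parent x) = 0.
Proof.
rewrite /parent digitDr // /digit divn_small ?spread_ltn //.
by rewrite mod0n.
Qed.

Lemma parent_ltn x : 0 < x -> parent x < x.
Proof.
move=> x0; rewrite [ltnRHS](divn_eq x (weight (lowest x).+1)) /parent addnC.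
rewrite ltn_add2l; apply: leq_trans (spread_ltn _ _) _.
apply: dvdn_leq.
  by rewrite lt0n -/(_ %| _) lowest_ndvd.
rewrite /dvdn modn_dvdm ?dvdn_weight //; exact: lowest_dvd.
Qed.

Lemma sum_expn2 n : \sum_(j < n) 2 ^ j = (2 ^ n).-1.
Proof.
elim: n => [|n IH]; first by rewrite big_ord0.
by rewrite big_ord_recr /= IH expnS; have := expn_gt0 2 n; lia.
Qed.

Lemma height_le n x : height n x <= (2 ^ n).-1.
Proof.
rewrite -sum_expn2 /height big_mkcond /=; apply: leq_sum => i _.
by case: ifP.
Qed.

Lemma heightS n x :
  height n.+1 x = height n x + (digit n x != 0) * 2 ^ n.
Proof.
rewrite /height big_mkcond big_ord_recr /= -big_mkcond; congr addn.
by case: ifP; rewrite ?mul1n ?mul0n.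
Qed.

Lemma height_dvd n x : weight n %| x -> height n x = 0.
Proof.
move=> h; rewrite /height big_pred0 // => j.
by rewrite (digit_dvd (ltn_ord j) h).
Qed.

Lemma height_full n x : (forall j, j < n -> digit j x != 0) ->
  height n x = (2 ^ n).-1.
Proof.
by move=> h; rewrite -sum_expn2; apply: eq_bigl => j; exact: h.
Qed.

(** With [v = lowest x], passing to the parent clears digit [v], makes all digits below [v] nonzero
    and keeps those above, so the height loses [2 ^ v] and gains [2 ^ v - 1]. *)
Lemma height_parent n x : lowest x < n -> 0 < x ->
  height n x = (height n (parent x)).+1.
Proof.
move=> + x0; elim: n => // n IH; rewrite ltnS leq_eqVlt => /orP [/eqP <-|h].
  rewrite !heightS height_dvd ?lowest_dvd // digit_parent_lowest.
  rewrite height_full; last by move=> j; exact: digit_parent_lt.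
  rewrite -lt0n digit_lowest //= mul0n mul1n.
  by have := expn_gt0 2 (lowest x); lia.
rewrite !heightS IH //.
by rewrite (eq_digit (x := x) (y := parent x) (leqnn n)) ?parent_divS.
Qed.

Lemma height_parent_dvd n x : n <= lowest x ->
  height n (parent x) = (2 ^ n).-1.
Proof.
move=> h; apply: height_full => j hj; apply: digit_parent_lt.
exact: leq_trans hj h.
Qed.

(** * The tree: acyclicity and connectedness *)

(** The guards exclude a loop at the root, since [parent 0] is 0. *)
Definition linked x y :=
  (0 < x) && (parent x == y) || (0 < y) && (parent y == x).

Lemma linked_sym : symmetric linked.
Proof. by move=> x y; rewrite /linked orbC. Qed.

Lemma linked_irr : irreflexive linked.
Proof.
move=> x; rewrite /linked orbb; apply/negP => /andP [x0 /eqP e].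
by have := parent_ltn x0; rewrite e ltnn.
Qed.

Lemma linked_parent x : 0 < x -> linked x (parent x).
Proof. by move=> x0; rewrite /linked x0 eqxx. Qed.

Lemma linked_gt x y : y < x -> linked x y -> y = parent x.
Proof.
move=> h /orP [/andP [_ /eqP //]|/andP [y0 /eqP e]].
by have := parent_ltn y0; rewrite e ltnNge ltnW.
Qed.

(** Both neighbours of the largest vertex of a cycle would be its parent, but they are distinct. *)
Lemma linked_ucycle c : 2 < size c -> ~ ucycle linked c.
Proof.
move=> hc uc.
have c0 : 0 < size c by lia.
have [m mc mmax] : exists2 m, m \in c & forall y, y \in c -> y <= m.
  exists (\max_(y <- c) y); last by move=> y yc; exact: leq_bigmax_seq.
  elim: c c0 {hc uc} => // y [|z c] IH _; first by rewrite big_seq1 mem_head.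
  rewrite big_cons inE /maxn; case: ifP => _; last by rewrite eqxx.
  by rewrite IH ?orbT.
have [i c' e] := rot_to mc.
move: uc; rewrite -(rot_ucycle i) e.
have sub y : y \in m :: c' -> y <= m by rewrite -e mem_rot; exact: mmax.
have : 2 < size (m :: c') by rewrite -e size_rot.
clear -sub D_gt1.
case/lastP: c' sub => // c' z; case: c' => // y c' sub _.
rewrite /ucycle /= rcons_path last_rcons => /and3P [] /and3P [my _ zm].
rewrite !inE !negb_or => /andP [ny nz] /andP [+ _].
rewrite mem_rcons inE negb_or => /andP [+ _].
have ym : y < m by rewrite ltn_neqAle eq_sym ny sub ?inE ?eqxx ?orbT.
have {}zm' : z < m.
  rewrite ltn_neqAle sub ?inE ?mem_rcons ?inE ?eqxx ?orbT // andbT.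
  by apply: contraNneq nz => ->; rewrite mem_rcons inE eqxx.
rewrite (linked_gt ym my) (linked_gt zm') ?eqxx //.
by rewrite linked_sym.
Qed.

Lemma path_to_root x :
  exists p, path linked x p /\ last x p = 0.
Proof.
elim/ltn_ind: x => [[|x]] IH; first by exists [::].
have [p [hp hl]] := IH _ (parent_ltn (ltn0Sn x)).
by exists (parent x.+1 :: p); rewrite /= linked_parent.
Qed.

Lemma path_to_block_root n x : exists p, [/\ path linked x p,
  last x p = x %/ weight n * weight n & size p = height n x].
Proof.
elim/ltn_ind: x => x IH.
have [d|nd] := boolP (weight n %| x).
  by exists [::]; rewrite /= divnK // height_dvd.
have x0 : 0 < x by case: x nd {IH} => //; rewrite dvdn0.
have h : lowest x < n by rewrite ltn_lowest.
have [p [hp hl hs]] := IH _ (parent_ltn x0).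
exists (parent x :: p); rewrite /= linked_parent //; split => //.
  by rewrite hl parent_divS.
by rewrite hs -height_parent.
Qed.

Lemma path_rev x p : path linked x p -> exists q,
  [/\ path linked (last x p) q, last (last x p) q = x & size q = size p].
Proof.
move=> hp; exists (rev (belast x p)); split; last 1 first.
- by rewrite size_rev size_belast.
- rewrite (eq_path (e' := fun z => linked^~ z)) ?rev_path //.
  exact: linked_sym.
- by case: p hp => //= y p _; rewrite rev_cons last_rcons.
Qed.

Lemma path_linked x y : exists p, path linked x p /\ last x p = y.
Proof.
have [p [hp hl]] := path_to_root x.
have [q [hq hl']] := path_to_root y.
have [q' []] := path_rev hq; rewrite hl' => hq' hl'' _.
by exists (p ++ q'); rewrite cat_path last_cat hp hl.
Qed.

Lemma path_in_block n x y : x %/ weight n = y %/ weight n -> exists p,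
  [/\ path linked x p, last x p = y & size p <= (2 ^ n).-1.*2].
Proof.
move=> e; have [p [hp hl hs]] := path_to_block_root n x.
have [q [hq hl' hs']] := path_to_block_root n y.
have [q' []] := path_rev hq; rewrite hl' -e -hl => hq' hl'' hs''.
exists (p ++ q'); rewrite cat_path last_cat hp; split => //.
by rewrite size_cat hs hs'' hs' -addnn leq_add // height_le.
Qed.

(** * Blocks of a fixed level and short walks *)

Definition block_parent n s := parent (s * weight n) %/ weight n.

(** Blocks of level [n] are indexed by quotients by [weight n]. An edge between two blocks joins the
    root of the child to a vertex of maximal height in the parent, so a walk through a block from
    root to attaching vertex takes at least [2 ^ n - 1] steps. *)
Lemma linked_block n x y : linked x y ->
  [\/ [/\ x %/ weight n = y %/ weight n,
          height n x <= (height n y).+1 & height n y <= (height n x).+1],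
      [/\ 0 < x %/ weight n, block_parent n (x %/ weight n) = y %/ weight n,
          height n x = 0 & height n y = (2 ^ n).-1] |
      [/\ 0 < y %/ weight n, block_parent n (y %/ weight n) = x %/ weight n,
          height n y = 0 & height n x = (2 ^ n).-1]].
Proof.
have up z : 0 < z ->
    [/\ z %/ weight n = parent z %/ weight n
      & height n z = (height n (parent z)).+1] \/
    [/\ 0 < z %/ weight n,
        block_parent n (z %/ weight n) = parent z %/ weight n,
        height n z = 0 & height n (parent z) = (2 ^ n).-1].
  move=> z0; have [h|h] := ltnP (lowest z) n.
    by left; rewrite parent_divS // height_parent.
  have d : weight n %| z by apply/negPn; rewrite -ltn_lowest // -leqNgt.
  right; rewrite height_dvd // height_parent_dvd //.
  rewrite /block_parent divnK // divn_gt0 ?weight_gt0 //.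
  by rewrite dvdn_leq.
case/orP => /andP [/up + /eqP <-].
  by case=> -[]; [constructor 1; split => //; lia|constructor 2].
by case=> -[]; [constructor 1; split => //; lia|constructor 3].
Qed.

Lemma short_path_blocks n x p : path linked x p -> size p <= (2 ^ n).-1 ->
  let b := x %/ weight n in let c := last x p %/ weight n in
  [\/ c = b, c = block_parent n b, 0 < c /\ block_parent n c = b |
      0 < c /\ block_parent n c = block_parent n b].
Proof.
move=> hp hs b.
suff : [\/ last x p %/ weight n = b,
     last x p %/ weight n = block_parent n b /\
       (2 ^ n).-1 < size p + height n (last x p),
     [/\ 0 < last x p %/ weight n, block_parent n (last x p %/ weight n) = b &
         height n (last x p) < size p] |
     [/\ 0 < last x p %/ weight n,
         block_parent n (last x p %/ weight n) = block_parent n b &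
         height n (last x p) < size p]].
  by case=> [|[]|[]|[]];
    [constructor 1|constructor 2|constructor 3|constructor 4].
(* The strengthened bounds prevent the walk from leaving a child through an
   attaching vertex, or the parent through its root. *)
elim/last_ind: p hp hs => [|p y IH]; first by constructor 1.
rewrite rcons_path last_rcons size_rcons => /andP [/IH {}IH].
move=> /(linked_block n) A hs; have {IH} := IH (ltnW hs).
move: A; set w := last x p.
case=> -[A1 A2 A3].
- rewrite -A1; case=> [|[]|[]|[]] B1.
  + by constructor 1.
  + by move=> ?; constructor 2; split => //; lia.
  + by move=> ? ?; constructor 3; split => //; lia.
  + by move=> ? ?; constructor 4; split => //; lia.
- move=> A4; case=> [|[]|[]|[]] B1.
  + by constructor 2; split; [rewrite -A2 B1|lia].
  + by lia.
  + by move=> B2 _; constructor 1; rewrite -A2.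
  + by move=> B2 _; constructor 2; split; [rewrite -A2|lia].
- move=> A4; case=> [|[]|[]|[]] B1.
  + by constructor 3; split; [|rewrite A2|lia].
  + by move=> _; constructor 4; split; [|rewrite A2|lia].
  + by lia.
  + by lia.
Qed.

(** * Siblings of a block and the encoding of balls *)

(** The digits of [spread v i] at positions [n] to [v - 1] are, up to a shift by 1, the lowest
    digits of [i] in the radices [D k - 1], the top position coming first. *)
Lemma spread_mod n v i j : n <= v ->
  spread v i %/ weight n = spread v j %/ weight n ->
  i = j %[mod \prod_(n <= k < v) (D k).-1].
Proof.
move=> /subnK <-; elim: (v - n) i j => [|k IH] i j /=.
  by rewrite add0n big_geq // !modn1.
rewrite addSn big_nat_recr ?leq_addl //=; set m := k + n.
have /dvdnP [q mE] := dvdn_weight (leq_addl k n).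
have wn := weight_gt0 n.
have lt a : spread m a %/ weight n < q.
  by rewrite ltn_divLR // -mE spread_ltn.
rewrite mE !mulnA !divnMDl // => e.
have q0 : 0 < q by apply: leq_ltn_trans (lt 0).
have e1 : i %% (D m).-1 = j %% (D m).-1.
  move: e => /(congr1 (divn^~ q)); rewrite !divnMDl //.
  by rewrite !(divn_small (lt _)) !addn0 => -[].
have e2 : spread m (i %/ (D m).-1) %/ weight n =
          spread m (j %/ (D m).-1) %/ weight n.
  by apply/eqP; move/eqP: e; rewrite e1 eqn_add2l.
have {e2}/IH e2 := e2.
rewrite (divn_eq i (D m).-1) (divn_eq j (D m).-1) e1.
by apply/eqP; rewrite eqn_modDr -!muln_modl e2.
Qed.

(** The block receiving a copy fixes the number of the copy modulo this product, by [spread_mod];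
    the quotient therefore tells apart the copies attached to one block. *)
Definition sibling_rank n s :=
  let x := s * weight n in
  (digit (lowest x) x).-1 %/ \prod_(n <= k < lowest x) (D k).-1.

Lemma lowest_mul_weight n s : 0 < s -> n <= lowest (s * weight n).
Proof.
move=> s0; rewrite leqNgt ltn_lowest ?muln_gt0 ?s0 ?weight_gt0 //.
by rewrite dvdn_mull.
Qed.

Lemma sibling_rank_inj n s t : 0 < s -> 0 < t ->
  block_parent n s = block_parent n t ->
  sibling_rank n s = sibling_rank n t -> s = t.
Proof.
move=> s0 t0; rewrite /block_parent /sibling_rank.
have := lowest_mul_weight n s0; have := lowest_mul_weight n t0.
suff : s * weight n = t * weight n -> s = t.
  have : 0 < s * weight n by rewrite muln_gt0 s0 weight_gt0.
  have : 0 < t * weight n by rewrite muln_gt0 t0 weight_gt0.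
  set x := s * _; set y := t * _ => y0 x0 + ny nx e h; apply.
  (* [lowest x] is the first position from [n] on where [parent x] has digit 0, so the parent block
     determines it. *)
  have lE : lowest x = lowest y.
    have ed j : n <= j -> digit j (parent x) = digit j (parent y).
      by move=> hj; apply: eq_digit hj e.
    case: (ltngtP (lowest x) (lowest y)) => // hl.
      by have := digit_parent_lt hl; rewrite -ed // digit_parent_lowest.
    by have := digit_parent_lt hl; rewrite ed // digit_parent_lowest.
  have hx := digit_lowest x0; have hy := digit_lowest y0.
  have dx := lowest_dvd x; have dy := lowest_dvd y.
  have px := parent_div x; have py := parent_div y.
  have E1 : x %/ weight (lowest y).+1 = y %/ weight (lowest y).+1.
    by rewrite -py -[in LHS]lE -px lE !(divn_weight _ (leqW ny)) e.
  move: e h; rewrite /parent lE E1; rewrite lE in hx dx.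
  set v := lowest y in hx hy dx dy ny E1 *; move=> e h.
  set P := \prod_(n <= k < v) (D k).-1 in h.
  have E2 : (digit v x).-1 = (digit v y).-1 %[mod P].
    apply: spread_mod => //; move: e.
    have /dvdnP [q ->] := dvdn_weight (leqW ny).
    by rewrite mulnA ![_ + _ * weight n]addnC !divnMDl ?weight_gt0 // => /addnI.
  have {h}E2 : (digit v x).-1 = (digit v y).-1.
    by rewrite (divn_eq (digit v x).-1 P) (divn_eq (digit v y).-1 P) h E2.
  have E3 : digit v x = digit v y by rewrite -(prednK hx) E2 prednK.
  have E z : weight v %| z ->
      z = (z %/ weight v.+1 * D v + digit v z) * weight v.
    move=> d; rewrite /digit /= divnMA -divn_eq divnK //.
  by rewrite (E _ dx) (E _ dy) E1 E3.
by move=> /eqP; rewrite eqn_pmul2r ?weight_gt0 // => /eqP.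
Qed.

Hypothesis D_growth : forall n, D n.+1 * D n <= (D n).+1 ^ 3.

Lemma radix_le_prod n v : n <= v ->
  D v <= 12 * D n * \prod_(n <= k < v) (D k).-1.
Proof.
move=> nv.
(* For [y >= 2], [F y = max 24 (y + 10)] satisfies [F z <= (y - 1) * F y]
   whenever [z * y <= (y + 1) ^ 3]. *)
suff : maxn 24 (D v + 10) <= 12 * D n * \prod_(n <= k < v) (D k).-1 by lia.
move: nv => /subnK <-; elim: (v - n) => [|k IH].
  by rewrite add0n big_geq // muln1; have := D_gt1 n; lia.
rewrite addSn big_nat_recr ?leq_addl //= mulnA.
apply: leq_trans (leq_mul IH (leqnn _)).
have := D_gt1 (k + n); have := D_growth (k + n).
move: (D (k + n).+1) (D (k + n)) => z y.
rewrite !expnS expn0 muln1 => h y1.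
(* The general estimate [y ^ 2 + 3 y + 14 <= (y - 1) (y + 10)] needs [y >= 4]. *)
case: (ltnP y 4) => y4.
  have : y = 2 \/ y = 3 by lia.
  by case=> E; move: h; rewrite E; lia.
have : z <= y * y + 3 * y + 4.
  rewrite -ltnS -(@ltn_pmul2r y); last by lia.
  by apply: leq_ltn_trans h _; nia.
nia.
Qed.

(** The [D v - 1] copies of level [v] are spread over the product of the [D k - 1] blocks, which
    leaves at most [12 * D n] for each, whatever [v] is. *)
Lemma sibling_rank_ltn n s : 0 < s -> sibling_rank n s < 12 * D n.
Proof.
move=> s0; have := lowest_mul_weight n s0; rewrite /sibling_rank.
set x := s * _ => nx; rewrite ltn_divLR; last first.
  by rewrite big_nat prodn_cond_gt0 // => k _; exact: D1_gt0.
apply: leq_trans (radix_le_prod nx); have := digit_ltn (lowest x) x.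
by have := D_gt1 (lowest x); lia.
Qed.

(** [r] has disjoint ranges for the four cases of [short_path_blocks]: the block of [x], its parent,
    its children, its siblings. *)
Definition ball_code n x y :=
  let b := x %/ weight n in let c := y %/ weight n in
  let r := if c == b then 0 else
    if c == block_parent n b then 1 else
    if block_parent n c == b then 2 + sibling_rank n c else
    2 + 12 * D n + sibling_rank n c in
  r * weight n + y %% weight n.

Lemma ball_code_ltn n x p : path linked x p -> size p <= (2 ^ n).-1 ->
  ball_code n x (last x p) < 25 * weight n.+1.
Proof.
move=> hp hs; have := short_path_blocks hp hs; rewrite /ball_code /=.
have := ltn_pmod (last x p) (weight_gt0 n).
have := @sibling_rank_ltn n (last x p %/ weight n).
set b := x %/ _; set c := _ %/ _; set k := sibling_rank _ _.
set r := _ %% _ => hk hr H.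
set q := if _ then _ else _.
(* There are [2 + 24 * D n] values for [q], and [2 <= D n]. *)
have hq : q.+1 <= 25 * D n.
  have Dn := D_gt1 n.
  rewrite /q; case: eqVneq => [_|c1]; first by lia.
  case: eqVneq => [_|c2]; first by lia.
  by case: eqVneq => c3; case: H => [||[]|[]] // *; have := hk; lia.
by have := leq_mul hq (leqnn (weight n)); lia.
Qed.

Lemma ball_code_inj n x p q : path linked x p -> path linked x q ->
  size p <= (2 ^ n).-1 -> size q <= (2 ^ n).-1 ->
  ball_code n x (last x p) = ball_code n x (last x q) -> last x p = last x q.
Proof.
move=> hp hq sp sq e.
have modE := congr1 (modn^~ (weight n)) e.
have divE := congr1 (divn^~ (weight n)) e.
move: modE divE; rewrite /ball_code !modnMDl !modn_mod.
rewrite !divnMDl ?weight_gt0 //.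
rewrite ![(_ %% weight n) %/ _]divn_small ?ltn_pmod ?weight_gt0 // !addn0.
have := short_path_blocks hp sp; have := short_path_blocks hq sq.
have := @sibling_rank_ltn n (last x p %/ weight n).
have := @sibling_rank_ltn n (last x q %/ weight n).
have := @sibling_rank_inj n (last x p %/ weight n) (last x q %/ weight n).
move=> /=.
set y := last x p; set z := last x q; set b := x %/ _.
set c := y %/ _; set d := z %/ _ => inj hd hc Hd Hc me.
have {}me : c = d -> y = z.
  move=> E; rewrite (divn_eq y (weight n)).
  by rewrite (divn_eq z (weight n)) -/c -/d E me.
move=> H; apply: me; move: H inj hd hc Hd Hc; clearbody c d b; clear.
move: (block_parent n) (sibling_rank n) (12 * D n) => P k M.
move=> + inj hd hc Hd Hc.
case: (eqVneq c b) => cb; case: (eqVneq d b) => db; first by rewrite cb db.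
- by case: ifP => _; last case: ifP => _; lia.
- by case: ifP => _; last case: ifP => _; lia.
case: (eqVneq c (P b)) => cP; case: (eqVneq d (P b)) => dP;
  first by rewrite cP dP.
- by case: ifP => _; lia.
- by case: ifP => _; lia.
(* Now [c] and [d] are nonzero blocks, each attached to [b] or to [P b], as injectivity of the rank
   requires. *)
have {}Hc : 0 < c /\ (P c == b = false -> P c = P b).
  by case: Hc cb cP => [->|->|[c0 ->]|[c0 ->]]; rewrite ?eqxx.
have {}Hd : 0 < d /\ (P d == b = false -> P d = P b).
  by case: Hd db dP => [->|->|[d0 ->]|[d0 ->]]; rewrite ?eqxx.
move: Hc Hd => [c0 Hc] [d0 Hd]; have {}hc := hc c0; have {}hd := hd d0.
case: eqP Hc => [cB _|_ /(_ erefl) cB]; case: eqP Hd => [dB _|_ /(_ erefl) dB];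
  [|lia|lia|] => h; apply: inj => //; by [rewrite cB dB|lia].
Qed.

End MixedRadix.

(** * Cardinalities of balls in the digit tree *)

Import Order.TTheory GRing.Theory Num.Theory.
Local Open Scope classical_set_scope.
Local Open Scope ring_scope.

Lemma card_le_inj T U (f : T -> U) (A : set T) (B : set U) :
  {in A &, injective f} -> (forall x, A x -> B (f x)) -> (A #<= B)%card.
Proof.
move=> /Pinj[g fg] AB; rewrite -(card_le_eql (card_image g)) -fg.
by apply: subset_card_le => _ [x Ax <-]; exact: AB.
Qed.

Lemma counting_le (R : realType) (T : choiceType) (A : set T) n :
  (A #<= `I_n)%card -> (counting A <= (n%:R : R)%:E)%E.
Proof.
move=> An; rewrite /counting asboolT; last by apply/finite_set_leP; exists n.
by rewrite lee_fin ler_nat geq_card_fset_set.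
Qed.

Lemma counting_ge (R : realType) (T : choiceType) (A : set T) n :
  (`I_n #<= A)%card -> ((n%:R : R)%:E <= counting A)%E.
Proof.
move=> An; rewrite /counting; case: asboolP => [fA|_]; last exact: leey.
by rewrite lee_fin ler_nat leq_card_fset_set.
Qed.

Section DigitTree.
Variable D : nat -> nat.
Hypothesis D_gt1 : forall n, (1 < D n)%N.

Definition digit_tree : sgraph :=
  SGraph (linked_sym D) (linked_irr D_gt1).

Lemma digit_tree_is_tree : is_tree digit_tree.
Proof.
split; first by exists (0%N : digit_tree).
- move=> v w; have [p ?] := path_linked D_gt1 v w.
  by exists p.
- by move=> c; exact: linked_ucycle.
Qed.

Lemma gball_digit_tree_ge (R : realType) n (r : R) (v : digit_tree) :
  (2 ^ n).-1.*2%:R <= r -> (((weight D n)%:R : R)%:E <= counting (gball v r))%E.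
Proof.
move=> nr; apply: counting_ge.
pose b := (v %/ weight D n * weight D n)%N.
apply: (@card_le_inj _ _ (addn b)) => [i j _ _ /addnI //|i /= iN].
have [|p [hp hl hs]] := @path_in_block D D_gt1 n v (b + i).
  by rewrite divnMDl ?weight_gt0 // [(i %/ _)%N]divn_small ?addn0.
apply: le_trans (_ : ((size p)%:R : R)%:E <= _)%E.
  by apply: ereal_inf_lbound; exists p.
by rewrite lee_fin; apply: le_trans nr; rewrite ler_nat.
Qed.

Lemma gball_digit_tree_le (R : realType) n (r : R) (v : digit_tree) :
  (forall n, D n.+1 * D n <= (D n).+1 ^ 3)%N -> r < (2 ^ n)%:R ->
  (counting (gball v r) <= ((25 * weight D n.+1)%:R : R)%:E)%E.
Proof.
move=> D_growth rn; apply: counting_le.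
have short w : w \in gball v r -> exists p,
    [/\ path (linked D) v p, last v p = w & (size p <= (2 ^ n).-1)%N].
  (* As [r < 2 ^ n] is strict, some walk is shorter than [2 ^ n], whether or not the infimum is
     attained. *)
  rewrite inE => /le_lt_trans/(_ _)/ereal_inf_lt; rewrite -lte_fin in rn.
  case/(_ _ rn) => _ [p [hp hl] <-]; rewrite lte_fin ltr_nat => hs.
  by exists p; split => //; rewrite -ltnS prednK ?expn_gt0.
apply: (@card_le_inj _ _ (ball_code D n v)) => [y z /short + /short|y].
  by move=> [p [hp <- sp]] [q [hq <- sq]]; exact: ball_code_inj.
rewrite -[gball _ _ _]/(_ : Prop) -in_setE => /short [p [hp <- sp]].
exact: ball_code_ltn.
Qed.

End DigitTree.

(** * Integer radices approximating a growth sequence *)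

Section DigitsOfGrowth.
Variables (R : realType) (G : nat -> R).
Hypothesis G0 : G 0%N = 1.
Hypothesis G_double : forall n, 2 * G n <= G n.+1.
Hypothesis G_lc : forall n, G n.+2 * G n ^+ 2 <= G n.+1 ^+ 3.

Lemma growth_digits : exists D : nat -> nat, [/\ forall n, (1 < D n)%N,
  forall n, (D n.+1 * D n <= (D n).+1 ^ 3)%N &
  forall n, (weight D n)%:R <= G n <= 2 * (weight D n)%:R].
Proof.
(* Greedy choice: [W n.+1] is the largest multiple of [W n] not above [G n.+1]. The error is below
   [W n], hence below [W n.+1], which gives the factor 2. *)
pose fix W n := if n is m.+1 then (W m * Num.truncn (G m.+1 / (W m)%:R))%N
                else 1%N.
pose D n := Num.truncn (G n.+1 / (W n)%:R).
have WE n : weight D n = W n by elim: n => //= n ->.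
have Gpos n : 0 < G n.
  by elim: n => [|n IH]; [rewrite G0|have := G_double n; lra].
have main n : [/\ (0 < W n)%N, (W n)%:R <= G n & G n <= 2 * (W n)%:R] ->
    [/\ (1 < D n)%N, (W n.+1)%:R <= G n.+1 & G n.+1 < (W n)%:R * (D n).+1%:R].
  move=> [W0 WG _]; have W0' : 0 < (W n)%:R :> R by rewrite ltr0n.
  have /truncn_itv : 0 <= G n.+1 / (W n)%:R by rewrite divr_ge0 // ltW.
  rewrite -/(D n) ler_pdivlMr // ltr_pdivrMr // => /andP [h1 h2]; split.
  - rewrite -ltnS -(ltr_nat R) -(ltr_pM2r W0').
    by apply: le_lt_trans h2; have := G_double n; lra.
  - by rewrite /= -/(D n) natrM mulrC.
  - by rewrite mulrC.
have inv n : [/\ (0 < W n)%N, (W n)%:R <= G n & G n <= 2 * (W n)%:R].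
  elim: n => [|n IH]; first by rewrite G0; split=> //=; lra.
  have [D1 WG GW] := main n IH; case: IH => W0 WG' _; split => //.
    by rewrite /= -/(D n) muln_gt0 W0 ltnW.
  have := G_double n; move: GW; rewrite /= -/(D n) natrM.
  rewrite -[(D n).+1]addn1 natrD mulrDr mulr1.
  by lra.
exists D; split => [n|n|n].
- by have [] := main n (inv n).
- have [W0 WG _] := inv n; have [D1 _ GW] := main n (inv n).
  have [_ + _] := main n.+1 (inv n.+1); rewrite /= -/(D n) -/(D n.+1) => h.
  have W0' : 0 < (W n)%:R :> R by rewrite ltr0n.
  (* After this scaling the left side is [W n.+2 * W n ^ 2], at most
     [G n.+2 * G n ^ 2 <= G n.+1 ^ 3], while [G n.+1 < W n * (D n).+1]. *)
  rewrite -(ler_nat R) -(ler_pM2r (_ : 0 < (W n)%:R ^+ 3 :> R)) ?exprn_gt0 //.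
  rewrite [leRHS](_ : _ = ((W n)%:R * (D n).+1%:R) ^+ 3); last first.
    by rewrite natrX exprMn mulrC.
  apply: le_trans (_ : G n.+1 ^+ 3 <= _); last first.
    by apply: lerXn2r (ltW GW); rewrite nnegrE ?mulr_ge0 // ltW.
  apply: le_trans (G_lc n); 
  apply: le_trans (_ : G n.+2 * (W n)%:R ^+ 2 <= _); last first.
    by rewrite ler_pM2l // lerXn2r // nnegrE ltW.
  rewrite exprS mulrA ler_pM2r ?exprn_gt0 //; apply: le_trans h.
  by rewrite -natrM ler_nat; lia.
- by rewrite WE; have [_ -> ->] := inv n.
Qed.

End DigitsOfGrowth.

(** * Log-concavity along doubling scales *)

Section ScaledGrowth.
Variables (R : realType) (g : R -> R).
Hypothesis g_nonneg : nonneg_valued g.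
Hypothesis g_incr : strictly_increasing g.

Lemma strictly_increasing_gt0 x : 0 < x -> 0 < g x.
Proof.
by move=> x0; apply: le_lt_trans (g_incr (lexx 0) x0); exact: g_nonneg.
Qed.

Lemma strictly_increasing_le x y : 0 <= x -> x <= y -> g x <= g y.
Proof.
move=> x0; rewrite le_eqVlt => /predU1P [->//|xy].
by rewrite ltW // g_incr.
Qed.

Lemma log_concave_doubling r0 x : log_concave_from g r0 -> r0 <= x -> 0 < x ->
  g (4 * x) * g x ^+ 2 <= g (2 * x) ^+ 3.
Proof.
move=> lc rx x0; have gp y : 0 < y -> 0 < g y by exact: strictly_increasing_gt0.
have g1 : 0 < g x by apply: gp.
have g2 : 0 < g (2 * x) by apply: gp; lra.
have g4 : 0 < g (4 * x) by apply: gp; lra.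
have := lc x (4 * x) (2 / 3) (1 / 3) rx.
have -> : 2 / 3 * x + 1 / 3 * (4 * x) = 2 * x by lra.
rewrite !lne_EFin // -!EFinM -EFinD lee_fin => /(_ _ _ _ _) H.
rewrite -ler_ln ?posrE ?mulr_gt0 ?exprn_gt0 //.
rewrite lnM ?posrE ?exprn_gt0 // !lnXn //.
have {}H := H ltac:(lra) ltac:(lra) ltac:(lra) ltac:(lra).
by rewrite -[_ *+ 2]mulr_natl -[_ *+ 3]mulr_natl; lra.
Qed.

End ScaledGrowth.

Theorem theorem1 (R : realType) (g : R -> R)
    (g_nonneg : nonneg_valued g)
    (g_incr : strictly_increasing g)
    (g_super : super_additive g)
    (g_lc : log_concave g \/ eventually_log_concave g) :
  exists T : sgraph, is_tree T /\ uniform_growth T g.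
Proof.
have [x0 x0_gt0 lc] : exists2 x0, 0 < x0 &
    forall x, x0 <= x -> g (4 * x) * g x ^+ 2 <= g (2 * x) ^+ 3.
  case: g_lc => [lc|[r0 r0_gt0 lc]].
    by exists 1 => // x x1; apply: (log_concave_doubling _ _ lc) => //; lra.
  by exists r0 => // x x1; apply: (log_concave_doubling _ _ lc) => //; lra.
have gx0 := strictly_increasing_gt0 g_nonneg g_incr x0_gt0.
have g_le := strictly_increasing_le g_incr.
pose G n := g (2 ^+ n * x0) / g x0.
have p0 n : 0 < 2 ^+ n :> R by rewrite exprn_gt0.
have [D [D_gt1 D_growth DG]] : exists D : nat -> nat, [/\ forall n, (1 < D n)%N,
    forall n, (D n.+1 * D n <= (D n).+1 ^ 3)%N &
    forall n, (weight D n)%:R <= G n <= 2 * (weight D n)%:R].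
  apply: growth_digits => [|n|n].
  - by rewrite /G mul1r divff // gt_eqF.
  - rewrite /G mulrA ler_pM2r ?invr_gt0 //.
    have h := mulr_gt0 (p0 n) x0_gt0.
    have := g_super _ _ (ltW h) (ltW h).
    rewrite exprS -mulrA [2 * (_ * _)]mulr_natl mulr2n; lra.
  - rewrite /G [in leLHS]exprMn mulrACA -exprS [leRHS]exprMn.
    rewrite ler_pM2r ?exprn_gt0 ?invr_gt0 //.
    have := lc (2 ^+ n * x0); rewrite !exprS !mulrA.
    rewrite (_ : 2 * 2 = 4 :> R); last by lra.
    by apply; rewrite ler_peMl ?exprn_ege1 ?(ltW x0_gt0) //; lra.
exists (digit_tree D_gt1); split; first exact: digit_tree_is_tree.
(* The factors [1 / 2] and 25 come from [G n <= 2 * weight D n] and the ball code, [g x0] from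
   normalising [G 0 = 1], and the 4s from rounding [r] to powers of 2. *)
exists (x0 / 4), (1 / (2 * g x0)), (4 * x0), (25 / g x0).
split; first by split; rewrite ?divr_gt0 ?mulr_gt0 //; lra.
move=> r v r0; have /andP [r1 r2] := truncn_itv r0.
move: (Num.truncn r) r1 r2 => m r1 r2; split=> [|r_ge1].
  (* The largest [n] with [2 * (2 ^ n - 1) <= m], the diameter bound of a block. *)
  pose n := (trunc_log 2 m.+2).-1.
  have /andP [n1 n2] : (2 ^ n.+1 <= m.+2 < 2 ^ n.+2)%N.
    have n0 : (0 < trunc_log 2 m.+2)%N by rewrite trunc_log_gt0.
    by rewrite /n prednK //; exact: trunc_log_bounds.
  apply: le_trans (gball_digit_tree_ge _ (_ : (2 ^ n).-1.*2%:R <= r)).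
    rewrite lee_fin; have /andP [_ h] := DG n.
    have : g (x0 / 4 * r) <= g (2 ^+ n * x0).
      apply: g_le; first by rewrite mulr_ge0 // divr_ge0 // ltW.
      have : r <= 2 ^+ n * 4.
        apply: le_trans (ltW r2) _; move: n2; rewrite -(ler_nat R) => n2.
        by rewrite -natrX -natrM ler_nat; move: n2; rewrite ler_nat !expnS; lia.
      move=> /(ler_wpM2l (ltW x0_gt0)); lra.
    move: h; rewrite /G ler_pdivrMr // => h h'.
    by rewrite mul1r mulrC ler_pdivrMr ?mulr_gt0 //; lra.
  apply: le_trans r1; rewrite ler_nat; move: n1; rewrite expnS; lia.
pose n := trunc_log 2 m.
(* Here [1 <= r] is essential: [2 ^ trunc_log 2 m <= m] fails at [m = 0]. *)
have m0 : (0 < m)%N by rewrite -ltnS -(ltr_nat R); apply: le_lt_trans r2.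
have /andP [n1 n2] : (2 ^ n <= m < 2 ^ n.+1)%N by exact: trunc_log_bounds.
apply: le_trans (gball_digit_tree_le _ D_growth (_ : r < (2 ^ n.+1)%:R)) _.
  by apply: lt_le_trans r2 _; rewrite ler_nat.
rewrite lee_fin natrM; have /andP [h _] := DG n.+2.
have : g (2 ^+ n.+2 * x0) <= g (4 * x0 * r).
  apply: g_le; first by rewrite mulr_ge0 // ltW.
  have : 2 ^+ n <= r by apply: le_trans r1; rewrite -natrX ler_nat.
  by move=> /(ler_wpM2l (ltW x0_gt0)); rewrite !exprS; lra.
move: h; rewrite /G ler_pdivlMr // => h h'.
by rewrite mulrAC ler_pdivlMr //; lra.
Qed.
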